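(* Let $A=[A_{ij}]_{i,j=1,2}\in M_n(\mathbb{F})$ be self-adjoint ($A^*=A$), with blocks $A_{ij}\in M_{n_i\times n_j}(\mathbb{F})$, $n=n_1+n_2$. If $0\leq A_{22}$ and $\ker A_{22}\subseteq\ker A_{12}$, then $J\operatorname{ppt}(A)$ is the unique self-adjoint matrix satisfying the minimization principle $$\frac12\left(\begin{bmatrix} x_1 \\ y_2 \end{bmatrix},J\operatorname{ppt}(A)\begin{bmatrix} x_1 \\ y_2 \end{bmatrix}\right)=\min_{x_2\in\mathbb{F}^{n_2}}\left\{\frac12\left(\begin{bmatrix} x_1 \\ x_2 \end{bmatrix},A\begin{bmatrix} x_1 \\ x_2 \end{bmatrix}\right)-\operatorname{Re}\left(y_2,(A_{22}A_{22}^+)x_2\right)\right\}$$ for all $(x_1,y_2)\in\mathbb{F}^{n_1}\times\mathbb{F}^{n_2}$. Furthermore, for each $(x_1,y_2)\in\mathbb{F}^{n_1}\times\mathbb{F}^{n_2}$, the set of minimizers is $$\{-A_{22}^+A_{21}x_1+A_{22}^+y_2\}+\ker A_{22}.$$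
   Context: $\mathbb{F}=\mathbb{R}$ or $\mathbb{F}=\mathbb{C}$; $M_{p\times q}(\mathbb{F})$ is the set of $p\times q$ matrices over $\mathbb{F}$ and $M_p(\mathbb{F})=M_{p\times p}(\mathbb{F})$. $(\cdot,\cdot)$ is the standard inner product on $\mathbb{F}^m$. $X^*$ is the (conjugate) transpose and $X^+$ the Moore-Penrose pseudoinverse of $X$. $0\leq X$ means that the self-adjoint matrix $X$ is positive semi-definite. For $A=\begin{bmatrix} A_{11} & A_{12} \\ A_{21} & A_{22} \end{bmatrix}\in M_n(\mathbb{F})$, the (generalized) Schur complement is $A/A_{22}=A_{11}-A_{12}A_{22}^+A_{21}$, the (generalized) principal pivot transform is $\operatorname{ppt}(A)=\begin{bmatrix} A/A_{22} & A_{12}A_{22}^+ \\ -A_{22}^+A_{21} & A_{22}^+ \end{bmatrix}$, and $J=\begin{bmatrix} I_{n_1} & 0 \\ 0 & -I_{n_2} \end{bmatrix}$, so that $J\operatorname{ppt}(A)=\begin{bmatrix} A/A_{22} & A_{12}A_{22}^+ \\ A_{22}^+A_{21} & -A_{22}^+ \end{bmatrix}$. *)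

(* Defs.v *)
From HB Require Import structures.
From mathcomp Require Import all_boot all_order all_algebra.
From mathcomp Require Import boolp classical_sets reals.
From mathcomp Require Import complex.

Set Implicit Arguments.
Unset Strict Implicit.
Unset Printing Implicit Defensive.

Import Order.TTheory GRing.Theory Num.Theory.
Local Open Scope classical_set_scope.
Local Open Scope ring_scope.

Variant real_or_complex := RealScalars | ComplexScalars.

(* The order of [R[i]] is partial: [z <= w] means that [w - z] is real and
   nonnegative, so an inequality between scalars includes the claim that the
   two sides differ by a real number. *)
Definition scalars (R : realType) (k : real_or_complex) : numFieldType :=
  match k with
  | RealScalars => R : numFieldType
  | ComplexScalars => R[i] : numFieldType
  end.

Definition conjS (R : realType) (k : real_or_complex) :
    scalars R k -> scalars R k :=
  match k with
  | RealScalars => fun x => x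
  | ComplexScalars => fun z => Num.conj (z : R[i])
  end.

(* The real part is kept inside the field of scalars. *)
Definition ReS (R : realType) (k : real_or_complex) :
    scalars R k -> scalars R k :=
  match k with
  | RealScalars => fun x => x
  | ComplexScalars => fun z => 'Re (z : R[i])
  end.

Section MatrixNotions.
Context {R : realType} {k : real_or_complex}.
Local Notation F := (scalars R k).

Definition adjmx m n (X : 'M[F]_(m, n)) : 'M[F]_(n, m) :=
  map_mx (@conjS R k) X^T.

Definition selfadjmx n (X : 'M[F]_n) : Prop := adjmx X = X.

Definition inner n (x y : 'cV[F]_n) : F := \sum_(i < n) conjS (x i 0) * y i 0.

Definition psdmx n (X : 'M[F]_n) : Prop :=
  selfadjmx X /\ forall x : 'cV[F]_n, 0 <= inner x (X *m x).

(* The kernel of X acting on column vectors ([kermx] is the left kernel). *)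
Definition mxker m n (X : 'M[F]_(m, n)) : set 'cV[F]_n := [set v | X *m v = 0].

Definition penrose m n (X : 'M[F]_(m, n)) (P : 'M[F]_(n, m)) : Prop :=
  [/\ X *m P *m X = X, P *m X *m P = P,
      selfadjmx (X *m P) & selfadjmx (P *m X)].

(* The default value 0 is never used, see [mp_pinvP]. *)
Definition mp_pinv m n (X : 'M[F]_(m, n)) : 'M[F]_(n, m) :=
  xget 0 [set P | penrose X P].

Definition schur_compl n1 n2 (A : 'M[F]_(n1 + n2)) : 'M[F]_n1 :=
  ulsubmx A - ursubmx A *m mp_pinv (drsubmx A) *m dlsubmx A.

Definition ppt n1 n2 (A : 'M[F]_(n1 + n2)) : 'M[F]_(n1 + n2) :=
  block_mx (schur_compl A) (ursubmx A *m mp_pinv (drsubmx A))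
           (- (mp_pinv (drsubmx A) *m dlsubmx A)) (mp_pinv (drsubmx A)).

Definition Jmx n1 n2 : 'M[F]_(n1 + n2) := block_mx 1%:M 0 0 (- 1%:M).

Definition argmin (T : Type) (f : T -> F) : set T :=
  [set x | forall y, f x <= f y].

Definition is_min (T : Type) (f : T -> F) (v : F) : Prop :=
  exists2 x, argmin f x & f x = v.

Definition objective n1 n2 (A : 'M[F]_(n1 + n2)) (x1 : 'cV[F]_n1)
    (y2 x2 : 'cV[F]_n2) : F :=
  2^-1 * inner (col_mx x1 x2) (A *m col_mx x1 x2)
  - ReS (inner y2 (drsubmx A *m mp_pinv (drsubmx A) *m x2)).

Definition minimization_principle n1 n2 (A M : 'M[F]_(n1 + n2)) : Prop :=
  forall (x1 : 'cV[F]_n1) (y2 : 'cV[F]_n2),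
    is_min (objective A x1 y2)
           (2^-1 * inner (col_mx x1 y2) (M *m col_mx x1 y2)).

End MatrixNotions.

Arguments Jmx {R k} n1 n2.

Section PseudoinverseExists.
Context {R : realType} {k : real_or_complex}.
Local Notation F := (scalars R k).

Fact conjS_is_zmod_morphism : zmod_morphism (@conjS R k).
Proof. by case: k => //= x y; rewrite rmorphB. Qed.
Fact conjS_is_monoid_morphism : monoid_morphism (@conjS R k).
Proof. by case: k => //=; split=> [|x y]; rewrite ?rmorph1 ?rmorphM. Qed.
HB.instance Definition _ :=
  GRing.isZmodMorphism.Build F F (@conjS R k) conjS_is_zmod_morphism.
HB.instance Definition _ :=
  GRing.isMonoidMorphism.Build F F (@conjS R k) conjS_is_monoid_morphism.

Lemma conjSK : involutive (@conjS R k).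
Proof. by case: k => //= x; rewrite conjCK. Qed.

Lemma conjS_mul_ge0 (x : F) : 0 <= x * conjS x.
Proof. by case: k x => /= x; [rewrite -expr2 sqr_ge0 | rewrite mul_conjC_ge0]. Qed.

Lemma conjS_mul_eq0 (x : F) : x * conjS x = 0 -> x = 0.
Proof. by move/eqP; rewrite mulf_eq0 fmorph_eq0 orbb => /eqP. Qed.

Lemma adjmxM m n p (X : 'M[F]_(m, n)) (Y : 'M[F]_(n, p)) :
  adjmx (X *m Y) = adjmx Y *m adjmx X.
Proof. by rewrite /adjmx trmx_mul map_mxM. Qed.

Lemma adjmxK m n (X : 'M[F]_(m, n)) : adjmx (adjmx X) = X.
Proof. by apply/matrixP=> i j; rewrite !mxE conjSK. Qed.

Lemma mulmx_adj_eq0 n (u : 'rV[F]_n) : u *m adjmx u = 0 -> u = 0.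
Proof.
move/matrixP/(_ 0 0); rewrite !mxE.
under eq_bigr do rewrite !mxE; move/eqP.
rewrite psumr_eq0 => [|i _]; last exact: conjS_mul_ge0.
move/allP=> u0; apply/rowP=> i; rewrite mxE; apply: conjS_mul_eq0.
by apply/eqP; apply: u0; rewrite mem_index_enum.
Qed.

Lemma gram_unitmx r n (B : 'M[F]_(r, n)) :
  row_free B -> B *m adjmx B \in unitmx.
Proof.
move=> freeB; rewrite -row_free_unit -kermx_eq0 -submx0; apply/row_subP=> i.
have : row i (kermx (B *m adjmx B)) *m (B *m adjmx B) = 0.
  by apply/sub_kermxP; apply: row_sub.
set u := row i _ => uG0; suff -> : u = 0 by apply: sub0mx.
suff uB0 : u *m B = 0 by apply: (row_free_inj freeB); rewrite mul0mx.
by apply: mulmx_adj_eq0; rewrite adjmxM !mulmxA -(mulmxA u) uG0 mul0mx.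
Qed.

Lemma adjmx_inv n (G : 'M[F]_n) : selfadjmx G -> selfadjmx (invmx G).
Proof.
by rewrite /selfadjmx /adjmx trmx_inv map_invmx => ->.
Qed.

Lemma penrose_rank_factorization m n r (C : 'M[F]_(m, r)) (B : 'M[F]_(r, n)) :
  row_full C -> row_free B -> exists P, penrose (C *m B) P.
Proof.
move=> fullC freeB; pose G := B *m adjmx B; pose H := adjmx C *m C.
have uG : G \in unitmx by apply: gram_unitmx.
have uH : H \in unitmx.
  rewrite -[H]/(adjmx C *m C) -{2}[C]adjmxK; apply: gram_unitmx.
  by rewrite /row_free mxrank_map mxrank_tr.
have saG : selfadjmx (invmx G).
  by apply: adjmx_inv; rewrite /selfadjmx adjmxM adjmxK.
have saH : selfadjmx (invmx H).
  by apply: adjmx_inv; rewrite /selfadjmx adjmxM adjmxK.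
exists (adjmx B *m invmx G *m invmx H *m adjmx C).
set P := _ *m _ *m _ *m _.
have XP : C *m B *m P = C *m invmx H *m adjmx C.
  by rewrite /P !mulmxA -(mulmxA C B) -/G mulmxK.
have PX : P *m (C *m B) = adjmx B *m invmx G *m B.
  by rewrite /P !mulmxA -(mulmxA _ _ C) -/H mulmxKV.
split.
- by rewrite XP !mulmxA -(mulmxA _ _ C) -/H mulmxKV.
- by rewrite PX /P !mulmxA -(mulmxA _ B (adjmx B)) -/G mulmxKV.
- by rewrite XP /selfadjmx !adjmxM adjmxK saH mulmxA.
- by rewrite PX /selfadjmx !adjmxM adjmxK saG mulmxA.
Qed.

Lemma penrose_exists m n (X : 'M[F]_(m, n)) : exists P, penrose X P.
Proof.
have := penrose_rank_factorization (col_base_full X) (row_base_free X).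
by rewrite mulmx_base.
Qed.

Lemma penrose_unique m n (X : 'M[F]_(m, n)) P Q :
  penrose X P -> penrose X Q -> P = Q.
Proof.
move=> [XPX PXP saXP saPX] [XQX QXQ saXQ saQX].
have XPQ : X *m P = X *m Q.
  by rewrite -saXP -{1}XQX -(mulmxA _ X P) adjmxM saXP saXQ mulmxA XPX.
have PQX : P *m X = Q *m X.
  by rewrite -saPX -{1}XQX -mulmxA mulmxA adjmxM saPX saQX -!mulmxA
             (mulmxA X) XPX.
by rewrite -PXP PQX -mulmxA XPQ mulmxA.
Qed.

Lemma mp_pinvP m n (X : 'M[F]_(m, n)) : penrose X (mp_pinv X).
Proof. by have [P XP] := penrose_exists X; apply: (xgetPex 0); exists P. Qed.

End PseudoinverseExists.

(* Main.v *)
Require Import Defs.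
From mathcomp Require Import all_boot all_order all_algebra.
From mathcomp Require Import boolp classical_sets reals.
From mathcomp Require Import complex ring.
Import Order.TTheory GRing.Theory Num.Theory.
Local Open Scope classical_set_scope.
Local Open Scope ring_scope.

(** Write [D = A22], [B = A12], [C = A21 = B^*] and [P = D^+]. The kernel
    inclusion says that [B P D = B], hence [D P C = C]. With
    [x0 = - P C x1 + P y2], completing the square turns the objective into
    [1/2 ((x1, y2), J ppt(A) (x1, y2)) + 1/2 (x2 - x0, D (x2 - x0))].
    A vector that annihilates the form of a positive semi-definite matrix lies
    in its kernel: for [D] this gives the set of minimizers, and for the
    difference of two solutions (whose form is zero) it gives uniqueness. *)

(* [a / (b + 1)] is close to the minimizer [a / b], and avoids [b = 0]. *)
Lemma parabola_ge0_slope_eq0 (K : numFieldType) (a b : K) (t := a / (b + 1)) :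
  0 <= a -> 0 <= b -> 0 <= - (t * a) - t * a + t * (t * b) -> a = 0.
Proof.
move=> a0 b0; have b1 : 0 < b + 1 by rewrite ltr_wpDl.
have b1n : b + 1 != 0 by rewrite gt_eqF.
(* At this [t] the quadratic is a negative multiple of [a ^+ 2], so its nonnegativity forces
   [a ^+ 2 <= 0]. *)
have -> : - (t * a) - t * a + t * (t * b) =
          - (a ^+ 2 * ((b + 2) / (b + 1) ^+ 2)).
  by rewrite /t; field.
have c_gt0 : 0 < (b + 2) / (b + 1) ^+ 2.
  by rewrite divr_gt0 ?exprn_gt0 // ltr_wpDl.
rewrite oppr_ge0 pmulr_lle0 // => a2; apply/eqP; rewrite -sqrf_eq0 eq_le a2.
by rewrite exprn_ge0.
Qed.

(** * Inner products and forms of self-adjoint matrices *)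

Section InnerProduct.
Set Implicit Arguments.
Context {R : realType} {k : real_or_complex}.
Local Notation F := (scalars R k).

(** Gives the real part one algebraic form over both fields, which [ring] can handle. *)
Lemma ReSE (z : F) : ReS z = 2^-1 * (z + conjS z).
Proof.
rewrite /ReS /conjS; case: k z => /= z; last by rewrite /= ReE mulrC.
by rewrite -mulr2n -[z *+ 2]mulr_natl mulKf // pnatr_eq0.
Qed.

(** Over the complex numbers [0 <= t] already says that [t] is real. *)
Lemma conjS_ge0 (t : F) : 0 <= t -> conjS t = t.
Proof. by case: k t => //= t t0; apply/CrealP/ger0_real. Qed.

Lemma innerDr n (x y z : 'cV[F]_n) : inner x (y + z) = inner x y + inner x z.
Proof.
by rewrite /inner -big_split; apply: eq_bigr => i _; rewrite mxE mulrDr.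
Qed.

Lemma innerZr n (t : F) (x y : 'cV[F]_n) : inner x (t *: y) = t * inner x y.
Proof.
by rewrite /inner mulr_sumr; apply: eq_bigr => i _; rewrite mxE mulrCA.
Qed.

Lemma innerNr n (x y : 'cV[F]_n) : inner x (- y) = - inner x y.
Proof. by rewrite -scaleN1r innerZr mulN1r. Qed.

Lemma inner0r n (x : 'cV[F]_n) : inner x 0 = 0.
Proof. by rewrite -(scale0r 0) innerZr mul0r. Qed.

Lemma conjS_inner n (x y : 'cV[F]_n) : conjS (inner x y) = inner y x.
Proof.
by rewrite rmorph_sum; apply: eq_bigr => i _; rewrite rmorphM /= conjSK mulrC.
Qed.

Lemma innerDl n (x y z : 'cV[F]_n) : inner (y + z) x = inner y x + inner z x.
Proof. by rewrite -!(conjS_inner x) innerDr rmorphD. Qed.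

Lemma innerZl n (t : F) (x y : 'cV[F]_n) :
  inner (t *: y) x = conjS t * inner y x.
Proof. by rewrite -!(conjS_inner x) innerZr rmorphM. Qed.

Lemma innerNl n (x y : 'cV[F]_n) : inner (- y) x = - inner y x.
Proof. by rewrite -!(conjS_inner x) innerNr rmorphN. Qed.

Lemma inner_col_mx m n (x x' : 'cV[F]_m) (y y' : 'cV[F]_n) :
  inner (col_mx x y) (col_mx x' y') = inner x x' + inner y y'.
Proof.
rewrite /inner big_split_ord /=; congr (_ + _);
  by apply: eq_bigr => i _; rewrite ?col_mxEu ?col_mxEd.
Qed.

Lemma inner_adjmx m n (X : 'M[F]_(m, n)) x y :
  inner x (X *m y) = inner (adjmx X *m x) y.
Proof.
rewrite /inner; under eq_bigr do rewrite mxE mulr_sumr.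
rewrite exchange_big /=; apply: eq_bigr => j _.
rewrite mxE rmorph_sum mulr_suml; apply: eq_bigr => i _.
by rewrite !mxE rmorphM /= conjSK mulrA [conjS _ * _]mulrC.
Qed.

Lemma inner_ge0 n (x : 'cV[F]_n) : 0 <= inner x x.
Proof. by apply: sumr_ge0 => i _; rewrite mulrC conjS_mul_ge0. Qed.

Lemma inner_eq0 n (x : 'cV[F]_n) : inner x x = 0 -> x = 0.
Proof.
move=> /eqP; rewrite psumr_eq0 => [/allP x0|i _]; last first.
  by rewrite mulrC conjS_mul_ge0.
apply/colP => i; rewrite mxE; apply: conjS_mul_eq0; rewrite mulrC.
by apply/eqP/x0; rewrite mem_index_enum.
Qed.

Lemma inner_selfadj n (D : 'M[F]_n) (x y : 'cV[F]_n) :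
  selfadjmx D -> inner x (D *m y) = inner (D *m x) y.
Proof. by move=> saD; rewrite inner_adjmx saD. Qed.

(** In the cross terms [D] acts on [y] only, so a known value of [D *m y] can be substituted. *)
Lemma inner_subr_form n (D : 'M[F]_n) (x y : 'cV[F]_n) : selfadjmx D ->
  inner (x - y) (D *m (x - y)) =
  inner x (D *m x) - inner x (D *m y) - inner (D *m y) x + inner y (D *m y).
Proof.
move=> saD; rewrite mulmxBr !(innerDl, innerDr, innerNl, innerNr).
by rewrite [inner y (D *m x)]inner_selfadj //; ring.
Qed.

(** With [w = D *m x], the form at [x - t *: w] for real [t] is [- 2 t a + t^2 b], where
    [a = (w, w)] and [b = (w, D w)]. It is never negative, so its slope at [0] vanishes and
    [a = 0]. *)
Lemma psdmx_form_eq0 n (D : 'M[F]_n) (x : 'cV[F]_n) :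
  psdmx D -> inner x (D *m x) = 0 -> D *m x = 0.
Proof.
move=> [saD D_ge0] x0; apply: inner_eq0; set w := D *m x.
have := inner_ge0 w; have := D_ge0 w.
set b := inner w (D *m w); set a := inner w w => b0 a0.
pose t := a / (b + 1).
have ct : conjS t = t by rewrite conjS_ge0 // divr_ge0 // addr_ge0.
have := D_ge0 (x - t *: w).
rewrite inner_subr_form // x0 -scalemxAr !(innerZl, innerZr) ct.
rewrite [inner x _]inner_selfadj // -[inner (D *m w) x]inner_selfadj //.
rewrite -/w -/a -/b.
by rewrite add0r; apply: parabola_ge0_slope_eq0.
Qed.

(** The difference has zero form, so it is positive semi-definite and kills each basis vector. Over
    the reals self-adjointness matters: skew-symmetric matrices have zero form. *)
Lemma selfadjmx_form_inj n (M N : 'M[F]_n) : selfadjmx M -> selfadjmx N ->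
  (forall x : 'cV[F]_n, inner x (M *m x) = inner x (N *m x)) -> M = N.
Proof.
move=> saM saN MN; apply/eqP; rewrite -subr_eq0; apply/eqP.
have form0 (x : 'cV[F]_n) : inner x ((M - N) *m x) = 0.
  by rewrite mulmxBl innerDr innerNr MN subrr.
have psdMN : psdmx (M - N).
  split=> [|x]; last by rewrite form0.
  by rewrite /selfadjmx /adjmx linearB map_mxB -/(adjmx M) -/(adjmx N) saM saN.
apply/matrixP => i j.
have /colP/(_ i) := psdmx_form_eq0 psdMN (form0 (delta_mx j 0)).
by rewrite -colE !mxE.
Qed.

End InnerProduct.

(** * Adjoints, pseudoinverses and the pivot transform *)

Section PivotTransform.
Context {R : realType} {k : real_or_complex}.
Set Implicit Arguments.
Local Notation F := (scalars R k).

Lemma adjmxD m n (X Y : 'M[F]_(m, n)) : adjmx (X + Y) = adjmx X + adjmx Y.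
Proof. by rewrite /adjmx linearD map_mxD. Qed.

Lemma adjmxN m n (X : 'M[F]_(m, n)) : adjmx (- X) = - adjmx X.
Proof. by rewrite /adjmx linearN map_mxN. Qed.

Lemma adjmx_block m1 m2 n1 n2 (X : 'M[F]_(m1, n1)) (Y : 'M[F]_(m1, n2))
    (Z : 'M[F]_(m2, n1)) (T : 'M[F]_(m2, n2)) :
  adjmx (block_mx X Y Z T) =
  block_mx (adjmx X) (adjmx Z) (adjmx Y) (adjmx T).
Proof. by rewrite /adjmx tr_block_mx map_block_mx. Qed.

Lemma selfadjmx_adj n (X : 'M[F]_n) : selfadjmx X -> selfadjmx (adjmx X).
Proof. by move=> saX; rewrite /selfadjmx !saX. Qed.

(** Taking adjoints preserves the first two Penrose equations and exchanges the last two. *)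
Lemma penrose_adj m n (X : 'M[F]_(m, n)) P :
  penrose X P -> penrose (adjmx X) (adjmx P).
Proof.
move=> [XPX PXP saXP saPX].
split; rewrite -?adjmxM ?mulmxA ?XPX ?PXP //; exact: selfadjmx_adj.
Qed.

(** The adjoint of the pseudoinverse is again a pseudoinverse of [D], and there is only one. *)
Lemma mp_pinv_selfadj n (D : 'M[F]_n) : selfadjmx D -> selfadjmx (mp_pinv D).
Proof.
move=> saD; have /penrose_adj := mp_pinvP D.
by rewrite saD => /penrose_unique; apply; exact: mp_pinvP.
Qed.

Lemma mp_pinv_comm n (D : 'M[F]_n) :
  selfadjmx D -> D *m mp_pinv D = mp_pinv D *m D.
Proof.
move=> saD; have [_ _ <- _] := mp_pinvP D.
by rewrite adjmxM saD mp_pinv_selfadj.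
Qed.

Lemma mxker_sub_mulmx m p n q (X : 'M[F]_(m, n)) (Y : 'M[F]_(p, n))
    (W : 'M[F]_(n, q)) :
  mxker X `<=` mxker Y -> X *m W = 0 -> Y *m W = 0.
Proof.
move=> kerXY XW; apply/matrixP => i j.
have /kerXY/colP/(_ i) : mxker X (col j W).
  by rewrite /mxker /= colE mulmxA XW mul0mx.
by rewrite colE mulmxA -colE !mxE.
Qed.

(** Since [X P X = X] for [P = mp_pinv X], the columns of [1 - P X] lie in the kernel of [X], hence
    in that of [Y]. *)
Lemma mulmx_mp_pinvK m p n (X : 'M[F]_(m, n)) (Y : 'M[F]_(p, n)) :
  mxker X `<=` mxker Y -> Y *m (mp_pinv X *m X) = Y.
Proof.
move=> kerXY; have [XPX _ _ _] := mp_pinvP X.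
apply/eqP; rewrite -subr_eq0 -{2}[Y]mulmx1 -mulmxBr; apply/eqP.
by apply: (mxker_sub_mulmx kerXY); rewrite mulmxBr mulmxA XPX mulmx1 subrr.
Qed.

Context (n1 n2 : nat) (A : 'M[F]_(n1 + n2)) (saA : selfadjmx A).
Local Notation B := (ursubmx A).
Local Notation C := (dlsubmx A).
Local Notation D := (drsubmx A).
Local Notation P := (mp_pinv D).

Lemma selfadjmx_blocks :
  [/\ selfadjmx (ulsubmx A), adjmx B = C & selfadjmx D].
Proof.
have := saA; rewrite /selfadjmx -{1 2}[A]submxK adjmx_block.
by case/eq_block_mx => -> _ -> ->.
Qed.

Lemma Jmx_ppt :
  Jmx n1 n2 *m ppt A = block_mx (schur_compl A) (B *m P) (P *m C) (- P).
Proof.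
by rewrite mulmx_block !mul1mx !mul0mx !mulNmx !mul1mx addr0 add0r opprK
           !addr0 add0r.
Qed.

(** The sign in [Jmx] turns the lower left block [- P C] of [ppt A] into [P C], the adjoint of
    [B P]. *)
Lemma selfadjmx_Jmx_ppt : selfadjmx (Jmx n1 n2 *m ppt A).
Proof.
have [saA11 BC saD] := selfadjmx_blocks.
have CB : adjmx C = B by rewrite -BC adjmxK.
rewrite Jmx_ppt /selfadjmx adjmx_block /schur_compl adjmxD !adjmxN !adjmxM.
by rewrite saA11 BC CB mp_pinv_selfadj // mulmxA.
Qed.

Context (kerDB : mxker D `<=` mxker B).

Definition minimizer (x1 : 'cV[F]_n1) (y2 : 'cV[F]_n2) : 'cV[F]_n2 :=
  - (P *m C *m x1) + P *m y2.

Lemma objective_square x1 y2 x2 :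
  objective A x1 y2 x2 =
  2^-1 * inner (col_mx x1 y2) (Jmx n1 n2 *m ppt A *m col_mx x1 y2)
  + 2^-1 * inner (x2 - minimizer x1 y2) (D *m (x2 - minimizer x1 y2)).
Proof.
have [saA11 BC saD] := selfadjmx_blocks.
have saP := mp_pinv_selfadj saD; have [_ PDP saDP _] := mp_pinvP D.
have DPC : D *m P *m C = C.
  by rewrite -BC -{2}(mulmx_mp_pinvK kerDB) !adjmxM saD saP.
set c := C *m x1; set d := D *m P *m y2.
(* This is the stationarity equation [C x1 + D x2 = D P y2] of the objective at [minimizer]. *)
have Dx0 : D *m minimizer x1 y2 = d - c.
  by rewrite mulmxDr mulmxN !mulmxA DPC addrC.
have Pd : P *m d = P *m y2 by rewrite !mulmxA PDP.
rewrite inner_subr_form // Dx0 Jmx_ppt.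
rewrite /objective -{1}[A]submxK !mul_block_col !inner_col_mx ReSE conjS_inner.
(* Matrices are moved across the inner products until both sides are polynomials in the same atoms,
   built from [c], [d], [P c] and [P y2]. *)
rewrite [inner y2 (D *m P *m x2)]inner_selfadj //.
rewrite -[inner (D *m P *m x2) _]inner_selfadj //.
rewrite -/d /minimizer /schur_compl mulmxBl -!mulmxA -/c mulNmx.
rewrite !(innerDr, innerNr, innerDl, innerNl).
rewrite -![inner (P *m _) _]inner_selfadj //.
rewrite Pd ![inner x1 (B *m _)]inner_adjmx BC -/c.
ring.
Qed.

Context (D_psd : psdmx D).

(** In [objective_square] only the last term depends on [x2]. It is nonnegative and vanishes at
    [minimizer], so minimizing means that it is zero. *)
Lemma argmin_objective x1 y2 x2 :
  argmin (objective A x1 y2) x2 <-> D *m (x2 - minimizer x1 y2) = 0.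
Proof.
have half_gt0 : 0 < 2^-1 :> F by rewrite invr_gt0.
have [_ D_ge0] := D_psd; split=> [minx2 | x20 y].
  apply: psdmx_form_eq0 => //; apply/eqP; rewrite eq_le D_ge0 andbT.
  have := minx2 (minimizer x1 y2).
  by rewrite !objective_square subrr mulmx0 inner0r mulr0 lerD2l pmulr_rle0.
rewrite !objective_square x20 inner0r mulr0 lerD2l.
by rewrite mulr_ge0 // ltW.
Qed.

Lemma minimization_principle_Jmx_ppt :
  minimization_principle A (Jmx n1 n2 *m ppt A).
Proof.
move=> x1 y2; exists (minimizer x1 y2).
  by apply/argmin_objective; rewrite subrr mulmx0.
by rewrite objective_square subrr mulmx0 inner0r mulr0 addr0.
Qed.

End PivotTransform.

(** Antisymmetry suffices, so the order on the scalars may be partial. *)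
Lemma is_min_unique {R : realType} {k : real_or_complex} (T : Type)
    (f : T -> scalars R k) u v :
  is_min f u -> is_min f v -> u = v.
Proof.
move=> [x minx <-] [y miny <-].
by apply: le_anti; rewrite minx miny.
Qed.

Theorem theorem9 (R : realType) (k : real_or_complex) (n1 n2 : nat)
    (A : 'M[scalars R k]_(n1 + n2)) (A_sa : selfadjmx A)
    (A22_psd : psdmx (drsubmx A))
    (ker_sub : mxker (drsubmx A) `<=` mxker (ursubmx A)) :
  unique (fun M : 'M[scalars R k]_(n1 + n2) =>
            selfadjmx M /\ minimization_principle A M)
         (Jmx n1 n2 *m ppt A)
  /\ forall (x1 : 'cV[scalars R k]_n1) (y2 : 'cV[scalars R k]_n2),
       argmin (objective A x1 y2) =
       [set - (mp_pinv (drsubmx A) *m dlsubmx A *m x1)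
            + mp_pinv (drsubmx A) *m y2 + z | z in mxker (drsubmx A)].
Proof.
split; last first.
  move=> x1 y2; apply/seteqP; split=> [x2 | _ [z Dz <-]].
    move=> /(argmin_objective A_sa ker_sub A22_psd) Dx2.
    by exists (x2 - minimizer A x1 y2) => //; rewrite addrC subrK.
  apply/(argmin_objective A_sa ker_sub A22_psd).
  by rewrite -/(minimizer A x1 y2) addrC addKr.
have minJ := minimization_principle_Jmx_ppt A_sa ker_sub A22_psd.
split; first by split=> //; exact: selfadjmx_Jmx_ppt.
move=> M [saM minM]; apply: selfadjmx_form_inj => //.
  exact: selfadjmx_Jmx_ppt.
(* The halves of [x] serve as [x1] and [y2]: half of each form at [x] is the minimum of the same
   objective. *)
move=> x; rewrite -[x]vsubmxK.
have half0 : 2^-1 != 0 :> scalars R k by rewrite invr_eq0 pnatr_eq0.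
by apply: (mulfI half0); apply: is_min_unique (minJ _ _) (minM _ _).
Qed.
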